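(* Let $P(z)$ be a plant, $C(z;\theta)$ a controller with tunable parameter $\theta\in\Theta\subset\mathbb{R}^n$, and $T(z;\theta)=P(z)C(z;\theta)\{1+P(z)C(z;\theta)\}^{-1}$ the closed-loop transfer function from reference to output, as specified in the context. Let $u^D_{[0:N]}$, $y^D_{[0:N]}$ be noiseless input/output data of $P(z)$, let $\tilde r_{[0:N]}(\theta)=\{\tilde r_k(\theta)\}_{k=0}^N$, $\tilde r_{[0:N]}(\theta)=(C(z;\theta))^{-1}u^D_{[0:N]}+y^D_{[0:N]}$, be the fictitious reference signal, and assume $\tilde r_0(\theta)\neq 0$ and $1+P(z)C(z;\theta)\neq 0$ for every $\theta$. Let $r^D_{[0:N]}=\{r^D_k\}_{k=0}^N$ with $r^D_0\neq 0$ be the reference input specified by the designer. Let $M_{ref}(z)=L_{flat}(z)\{1+L_{flat}(z)\}^{-1}$ be the reference model constructed from a fractional-order open-loop transfer function with the flat-phase property (see context), let $m^{ref}=\{m^{ref}_k\}_{k=0}^\infty$ be its impulse response sequence, and put $m^{ref}_{[0:N]}=\{m^{ref}_k\}_{k=0}^N$. Consider the model-reference problem: on the basis of $u^D_{[0:N]}$ and $y^D_{[0:N]}$, find the optimal controller parameter $\theta^*$ such that $T(z;\theta^* )r^D_{[0:N]}$ is as close to $M_{ref}(z)r^D_{[0:N]}$ as possible in the mean square error sense. Then the solution of this problem is given by $$\theta^*=\arg\min_{\theta}J(\theta),$$ $$J(\theta)=\left\| R^D\,\bigl(\tilde R(\theta)\bigr)^{-1}\mathrm{vec}\bigl(y^D_{[0:N]}\bigr)-R^D\,\mathrm{vec}\bigl(m^{ref}_{[0:N]}\bigr)\right\|_2^2,$$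 where $R^D=\mathrm{Tpl}(\mathrm{vec}(r^D_{[0:N]}))$ and $\tilde R(\theta)=\mathrm{Tpl}(\mathrm{vec}(\tilde r_{[0:N]}(\theta)))$.
   Context: All discrete-time systems are single-input single-output (SISO), linear time-invariant (LTI), with rational transfer functions in $z$. If $G(z)$ is proper rational with impulse response $\{g_k\}_{k\ge 0}$, its output for an input $u=\{u_k\}$ is $y=G(z)u$ with $y_t=\sum_{\tau=0}^t g_\tau u_{t-\tau}$. Applied to a finite sequence indexed by $0,\dots,N$, $G(z)u_{[0:N]}$ denotes the output at times $0,\dots,N$. For a finite sequence $v=\{v_k\}_{k=0}^{N}$, $\mathrm{vec}(v)=[v_0\ v_1\ \cdots\ v_N]^\top\in\mathbb{R}^{N+1}$. For $v\in\mathbb{R}^m$ with components $v_1,\dots,v_m$, $\mathrm{Tpl}(v)\in\mathbb{R}^{m\times m}$ is the lower-triangular Toeplitz matrix with first column $v$: its $(i,j)$ entry is $v_{i-j+1}$ if $i\ge j$ and $0$ otherwise. $\|\cdot\|_2$ is the Euclidean norm. Control system: $P(z)$ is a proper rational transfer function (unknown to the designer), and $C(z;\theta)$ is a proper rational transfer function for any $\theta$; the controller class is given a priori by the designer and $\Theta\subset\mathbb{R}^n$ is the search range for $\theta$. They are connected in unity negative feedback, with closed-loop transfer function $T(z;\theta)$ from reference $r$ to output $y$. The data $u^D_{[0:N]}=\{u^D_k\}_{k=0}^N$ and $y^D_{[0:N]}=\{y^D_k\}_{k=0}^N$ are the input and output of $P(z)$ collected in an open-loop or closed-loop experiment and are noiseless,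 so $y^D_{[0:N]}=P(z)u^D_{[0:N]}$. The term $(C(z;\theta))^{-1}u^D_{[0:N]}$ is the result of filtering $u^D_{[0:N]}$ by the inverse transfer function $(C(z;\theta))^{-1}$. Reference model: $L_{flat}(s)$ is a continuous-time fractional-order SISO LTI transfer function (real powers of $s$ allowed) with the flat-phase property, i.e. $\frac{d}{ds}(\angle L_{flat}(s))\big|_{s=j\omega_c}=0$ at a frequency $\omega_c>0$ with $|L_{flat}(j\omega_c)|=1$, where $\angle$ denotes the argument. $L_{flat}(z)$ is the discrete-time transfer function obtained from $L_{flat}(s)$ by an integer-order approximation followed by a discretization. It is assumed that $L_{flat}(z)$ is proper and rational and that $M_{ref}(z)=L_{flat}(z)\{1+L_{flat}(z)\}^{-1}$ has all its poles inside the unit circle.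
   Formalization: It is additionally assumed that filtering u^D by C(z;θ)^{-1} gives no output before time 0 (automatic when C^{-1} is proper); for strictly proper C the filtered signal is otherwise undefined or the claim fails. C≠0, 1+L_flat≠0 and M_ref proper are made explicit. *)

(* Defs.v *)
(* MathComp + MathComp-Analysis; the field of reals is an abstract
   [R : realType]. *)
From HB Require Import structures.
From mathcomp Require Import all_boot all_order all_algebra.
From mathcomp Require Import complex ring.
From mathcomp Require Import all_classical all_reals all_analysis.

Set Implicit Arguments.
Unset Strict Implicit.
Unset Printing Implicit Defensive.

Import Order.TTheory GRing.Theory Num.Theory.
Import numFieldNormedType.Exports.
Local Open Scope classical_set_scope.
Local Open Scope ring_scope.
Local Open Scope complex_scope.

Notation transfer R := {fraction {poly R}}.

Section Transfer.
Variable R : realType.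
Implicit Types G L : transfer R.

Definition tf_num G : {poly R} :=
  (frac (repr G)).1 %/ gcdp (frac (repr G)).1 (frac (repr G)).2.
Definition tf_den G : {poly R} :=
  (frac (repr G)).2 %/ gcdp (frac (repr G)).1 (frac (repr G)).2.

Definition proper_tf G : bool := (size (tf_num G) <= size (tf_den G))%N.

Definition pole G (p : R[i]) : bool :=
  root (map_poly (real_complex R) (tf_den G)) p.

Definition unity_feedback L : transfer R := L * (1 + L)^-1.

(* The coefficient of z^-k (k : int) in the expansion of G at infinity.  For
   k >= 0 it is the constant term of the polynomial part of z^k G(z); for
   k < 0 it is a coefficient of the polynomial part of G, hence 0 when G is
   proper.  The convolution identity characterizing it is [expansionP]. *)
Definition expansion G (k : int) : R :=
  match k with
  | Posz n => (tf_num G * 'X^n %/ tf_den G)`_0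
  | Negz n => (tf_num G %/ tf_den G)`_n.+1
  end.

Definition impulse G (k : nat) : R := expansion G k%:Z.

(* Filtering is defined for every rational G, because C(z)^-1 need not be
   proper when C is: the input is extended by 0 outside 0..N, and the output
   is indexed by int since an improper G may respond before time 0.  For proper
   G this is the usual causal convolution, see [responseE]. *)
Definition filtered N G (u : 'I_N.+1 -> R) (t : int) : R :=
  \sum_(k < N.+1) expansion G (t - k%:Z) * u k.

Definition response N G (u : 'I_N.+1 -> R) : 'I_N.+1 -> R :=
  fun t => filtered G u t%:Z.

Lemma tf_den_neq0 G : tf_den G != 0.
Proof.
have d0 : (frac (repr G)).2 != 0 by [].
by rewrite dvdp_div_eq0 // dvdp_gcdr.
Qed.

Lemma tf_numdenE G :
  G = @FracField.tofrac _ (tf_num G) / @FracField.tofrac _ (tf_den G).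
Proof.
have d0 : (frac (repr G)).2 != 0 by [].
set g := gcdp (frac (repr G)).1 (frac (repr G)).2.
have g0 : @FracField.tofrac _ g != 0.
  by rewrite tofrac_eq0 gcdp_eq0 negb_and d0 orbT.
have nE : (frac (repr G)).1 = tf_num G * g by rewrite divpK // dvdp_gcdl.
have dE : (frac (repr G)).2 = tf_den G * g by rewrite divpK // dvdp_gcdr.
have {1}-> : G = @FracField.tofrac _ (frac (repr G)).1 /
                 @FracField.tofrac _ (frac (repr G)).2.
  rewrite -[LHS]reprK; move: (repr G) d0 => x d0.
  apply: (canRL (mulfK _)); first by rewrite tofrac_eq0.
  unlock FracField.tofrac; rewrite -[LHS]FracField.pi_mul.
  apply/eqP; rewrite FracField.equivf_def /FracField.mulf.
  by rewrite !numden_Ratio ?oner_eq0 ?mulr1 // mulrC.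
by rewrite nE dE !tofracM invfM mulrACA divff // mulr1.
Qed.

Lemma expansion_shift G (n j : nat) :
  (tf_num G * 'X^n %/ tf_den G)`_j = expansion G (n%:Z - j%:Z).
Proof.
have q0 := tf_den_neq0 G; rewrite /expansion.
move: (tf_num G) (tf_den G) q0 => p q q0.
elim: n j => [|n IH] [|j].
- by rewrite subr0.
- by rewrite expr0 mulr1 sub0r -NegzE.
- by rewrite subr0.
have -> : p * 'X^(n.+1) %/ q = (p * 'X^n %/ q) * 'X + (p * 'X^n %% q) * 'X %/ q.
  by rewrite exprSr mulrA {1}(divp_eq (p * 'X^n) q) mulrDl mulrAC divpD mulpK.
rewrite coefD coefMX /= [X in _ + X]nth_default ?addr0.
  have -> : n.+1%:Z - j.+1%:Z = n%:Z - j%:Z by rewrite !intS; ring.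
  exact: IH.
rewrite size_divp //.
have sr := ltn_modp (p * 'X^n) q; rewrite q0 in sr.
have [->|r0] := eqVneq (p * 'X^n %% q) 0; first by rewrite mul0r size_poly0.
rewrite size_mulX // leq_subLR; apply: leq_trans sr _.
by rewrite addnS; apply: leq_trans (leqSpred _) _; rewrite ltnS leq_addr.
Qed.

Lemma expansionP G (j : int) :
  \sum_(i < size (tf_den G)) (tf_den G)`_i * expansion G (i%:Z - j)
    = if j is Posz n then (tf_num G)`_n else 0.
Proof.
set q := tf_den G; set p := tf_num G.
pose n := (size q + `|j|)%N.
have [m jm] : exists m : nat, n%:Z + j = (size q + m)%:Z.
  case: (j) @n => k; first by exists (k + k)%N; rewrite -PoszD addnA.
  by exists 0%N; rewrite addn0 /= PoszD NegzE addrK.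
have coefE (i : 'I_(size q)) : expansion G (i%:Z - j) =
    (p * 'X^n %/ q)`_(size q + m - i).
  rewrite expansion_shift; congr (expansion G _).
  have im : (i <= size q + m)%N by apply: leq_trans (ltnW (ltn_ord i)) (leq_addr _ _).
  by rewrite -subzn // -jm; ring.
transitivity ((p * 'X^n)`_(size q + m)).
  rewrite [in RHS](divp_eq (p * 'X^n) q) coefD [X in _ + X]nth_default ?addr0.
    rewrite mulrC coefM.
    rewrite (big_ord_widen (size q + m).+1
      (fun i : nat => q`_i * expansion G (i%:Z - j))) ?leqW ?leq_addr //.
    rewrite big_mkcond; apply: eq_bigr => i _ /=.
    case: ifP => [iq|/negbT]; first by rewrite (coefE (Ordinal iq)).
    by rewrite -leqNgt => qi; rewrite [q`_i]nth_default // mul0r.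
  by apply: leq_trans (ltnW _) (leq_addr _ _); rewrite ltn_modp tf_den_neq0.
rewrite coefMXn; case: j @n jm {coefE} => k n /eqP jm.
  rewrite -PoszD eqz_nat in jm; move/eqP: jm => <-.
  by rewrite ltnNge leq_addr /= addKn.
suff -> : (size q + m < n)%N by [].
by rewrite -ltz_nat -(eqP jm) NegzE gtrDl oppr_lt0.
Qed.

Lemma responseE N G (u : 'I_N.+1 -> R) (t : 'I_N.+1) : proper_tf G ->
  response G u t = \sum_(tau < t.+1) impulse G tau * u (inord (t - tau)).
Proof.
rewrite /proper_tf => pG; rewrite /response /filtered.
have noncausal n : expansion G (Negz n) = 0.
  apply: nth_default; rewrite size_divp ?tf_den_neq0 // leq_subLR.
  apply: leq_trans pG _; case: (size _) => // s.
  by rewrite /= addnS ltnS leq_addr.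
transitivity (\sum_(k < t.+1) expansion G (t%:Z - k%:Z) * u (inord k)).
  rewrite (big_ord_widen N.+1
    (fun k : nat => expansion G (t%:Z - k%:Z) * u (inord k))) ?ltn_ord //.
  rewrite [RHS]big_mkcond; apply: eq_bigr => k _; rewrite inord_val.
  case: ifP => // /negbT; rewrite -leqNgt => tk.
  have -> : t%:Z - k%:Z = Negz (k - t.+1)%N.
    by rewrite NegzE -subSn // subSS -subzn ?opprB // ltnW.
  by rewrite noncausal mul0r.
rewrite (reindex_inj rev_ord_inj); apply: eq_bigr => k _ /=.
have kt : (k <= t)%N by rewrite -ltnS.
by rewrite subSS subzn ?leq_subr // subKn.
Qed.

End Transfer.

Section FractionalOrder.
Variable R : realType.

(* Quotients of finite sums of real powers of s: a pair (c, a) stands for the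
   term c s^a. *)
Record fractional_tf := FractionalTF {
  fractional_num : seq (R * R);
  fractional_den : seq (R * R) }.

(* (j w)^a for w > 0, principal branch. *)
Definition jomega_pow (w a : R) : R[i] :=
  (w `^ a * cos (a * (pi / 2))) +i* (w `^ a * sin (a * (pi / 2))).

Definition fractional_sum (p : seq (R * R)) (w : R) : R[i] :=
  \sum_(t <- p) t.1%:C * jomega_pow w t.2.

Definition freq_response (L : fractional_tf) (w : R) : R[i] :=
  fractional_sum (fractional_num L) w / fractional_sum (fractional_den L) w.

(* d(arg L)/ds = 0 at s = j wc, the derivative being taken along the imaginary
   axis.  The phase is any determination of the argument near wc that is
   differentiable at wc, so a jump of the principal value is harmless. *)
Definition flat_phase (L : fractional_tf) (wc : R) : Prop :=
  exists phase : R -> R,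
    (\forall w \near wc, freq_response L w =
       `|freq_response L w| * (cos (phase w) +i* sin (phase w))) /\
    is_derive wc 1 phase 0.

End FractionalOrder.

Section FiniteSequences.
Variable R : realType.

Definition vec N (v : 'I_N.+1 -> R) : 'cV[R]_N.+1 := \col_i v i.

Definition Tpl m (v : 'cV[R]_m) : 'M[R]_m :=
  \matrix_(i, j) if (j <= i)%N
                 then v (Ordinal (leq_ltn_trans (leq_subr j i) (ltn_ord i))) 0
                 else 0.

(* The norm `|v| of the library on matrices is the sup norm. *)
Definition euclidean_norm m (v : 'cV[R]_m) : R :=
  Num.sqrt (\sum_i v i 0 ^+ 2).

Definition mean_square_error N (v w : 'I_N.+1 -> R) : R :=
  (N.+1%:R)^-1 * \sum_i (v i - w i) ^+ 2.

Definition argmin (T : Type) (D : set T) (f : T -> R) : set T :=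
  [set x | D x /\ forall y, D y -> f x <= f y].

Definition fictitious_reference N (C : transfer R) (u y : 'I_N.+1 -> R) :
    'I_N.+1 -> R :=
  fun t => response C^-1 u t + y t.

End FiniteSequences.

(* Main.v *)
(* Signals indexed by the integers and vanishing far in the past form a
   torsion-free module over the polynomials, z acting as the forward shift, and
   the output y of G = p/q for the input u is the only such signal with
   q y = p u.  Hence the data satisfy T rtilde = yD: with e = C^-1 uD one has
   rtilde = (1 + P C) e and yD = P C e.  Since lower-triangular Toeplitz
   matrices applied to vectors commute, this says that Rtilde^-1 yD is the
   impulse response of T on 0..N, so J is N + 1 times the mean square error.
   T is proper: otherwise (1 + P C) would be strictly proper and, e being
   causal, rtilde would vanish at time 0. *)
Require Import Defs.
From HB Require Import structures.
From mathcomp Require Import all_boot all_order all_algebra.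
From mathcomp Require Import complex.
From mathcomp Require Import all_classical all_reals all_analysis.
From mathcomp Require Import zify ring.

Set Implicit Arguments.
Unset Strict Implicit.
Unset Printing Implicit Defensive.

Import Order.TTheory GRing.Theory Num.Theory.
Import numFieldNormedType.Exports.
Local Open Scope classical_set_scope.
Local Open Scope ring_scope.

(** * Polynomials acting on two-sided signals by the forward shift *)

Section ShiftAction.
Variable R : idomainType.
Implicit Types (p q : {poly R}) (s : int -> R).

Definition shift_act p s (t : int) : R :=
  \sum_(i < size p) p`_i * s (t + i%:Z).

Lemma shift_act_widen p s t n : (size p <= n)%N ->
  shift_act p s t = \sum_(i < n) p`_i * s (t + i%:Z).
Proof.
move=> pn.
rewrite /shift_act (big_ord_widen n (fun i : nat => p`_i * s (t + i%:Z))) //.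
rewrite big_mkcond; apply: eq_bigr => i _; case: ifP => // /negbT.
by rewrite -leqNgt => pi; rewrite nth_default // mul0r.
Qed.

Lemma shift_actDl p q s t :
  shift_act (p + q) s t = shift_act p s t + shift_act q s t.
Proof.
pose n := maxn (size p) (size q).
rewrite (@shift_act_widen p s t n) ?leq_maxl //.
rewrite (@shift_act_widen q s t n) ?leq_maxr //.
rewrite (@shift_act_widen (p + q) s t n) ?size_polyD // -big_split.
by apply: eq_bigr => i _; rewrite coefD mulrDl.
Qed.

Lemma shift_actC c s t : shift_act c%:P s t = c * s t.
Proof.
by rewrite (@shift_act_widen _ _ _ 1) ?size_polyC_leq1 // big_ord1 coefC addr0.
Qed.

Lemma shift_actMX p s t : shift_act (p * 'X) s t = shift_act p s (t + 1).
Proof.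
rewrite (@shift_act_widen _ _ _ (size p).+1); last first.
  by apply: leq_trans (size_polyMleq _ _) _; rewrite size_polyX addn2.
rewrite big_ord_recl coefMX mul0r add0r; apply: eq_bigr => i _.
by rewrite coefMX /= /bump /= add1n /= intS addrA.
Qed.

Lemma shift_actDr p s1 s2 t :
  shift_act p (fun x => s1 x + s2 x) t = shift_act p s1 t + shift_act p s2 t.
Proof. by rewrite /shift_act -big_split; apply: eq_bigr => i _; rewrite mulrDr. Qed.

Lemma shift_actBr p s1 s2 t :
  shift_act p (fun x => s1 x - s2 x) t = shift_act p s1 t - shift_act p s2 t.
Proof. by rewrite /shift_act -sumrB; apply: eq_bigr => i _; rewrite mulrBr. Qed.

Lemma eq_shift_act p s1 s2 : s1 =1 s2 -> shift_act p s1 =1 shift_act p s2.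
Proof. by move=> s12 t; apply: eq_bigr => i _; rewrite s12. Qed.

Lemma shift_actZl c p s t : shift_act (c%:P * p) s t = c * shift_act p s t.
Proof.
rewrite mul_polyC (@shift_act_widen _ _ _ (size p)) ?size_scale_leq //.
by rewrite big_distrr; apply: eq_bigr => i _; rewrite coefZ -mulrA.
Qed.

Lemma shift_actM p q s t :
  shift_act (p * q) s t = shift_act p (shift_act q s) t.
Proof.
elim/poly_ind: p t => [|p c IH] t.
  by rewrite mul0r /shift_act size_poly0 !big_ord0.
rewrite mulrDl !shift_actDl [p * _ * _]mulrAC !shift_actMX IH.
by rewrite shift_actC shift_actZl.
Qed.

(** Rules out homogeneous solutions: on arbitrary signals [shift_act q] can kill nonzero ones, such
    as geometric sequences. *)
Definition delayed s : Prop := exists m : int, forall t, t < m -> s t = 0.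

Lemma delayedD s1 s2 :
  delayed s1 -> delayed s2 -> delayed (fun t => s1 t + s2 t).
Proof.
move=> [m1 H1] [m2 H2]; exists (Num.min m1 m2) => t.
by rewrite lt_min => /andP[t1 t2]; rewrite H1 ?H2 ?addr0.
Qed.

Lemma delayedN s : delayed s -> delayed (fun t => - s t).
Proof. by move=> [m H]; exists m => t tm; rewrite H ?oppr0. Qed.

Lemma delayed_shift_act p s : delayed s -> delayed (shift_act p s).
Proof.
move=> [m H]; exists (m - (size p)%:Z) => t tm.
by rewrite /shift_act big1 // => i _; rewrite H ?mulr0 //; have := ltn_ord i; lia.
Qed.

(** The leading coefficient of [q] multiplies the latest sample, so each value is determined by
    earlier ones, starting from the zero past. The bound [M] makes this usable when the recurrence
    is known only up to a finite time. *)
Lemma shift_act_vanish q s (M : int) : q != 0 -> delayed s ->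
  (forall t, t <= M - (size q).-1%:Z -> shift_act q s t = 0) ->
  forall t, t <= M -> s t = 0.
Proof.
move=> q0 [m sm] H.
(* Induction on how far [t] may lie beyond the region where [s] is known to vanish. *)
suff Hn n t : t < m + n%:Z -> t <= M -> s t = 0.
  by move=> t; apply: (Hn `|t - m|.+1%N); lia.
elim: n t => [|n IH] t tn tM; first by apply: sm; lia.
pose d := (size q).-1.
(* At time [t - d], with [d] the degree of [q], the only sample not yet known to be zero is
   [s t]. *)
have := H (t - d%:Z); rewrite (@shift_act_widen _ _ _ d.+1) ?leqSpred //.
rewrite big_ord_recr big1 /= => [|i _]; last first.
  by rewrite IH ?mulr0 //; have := ltn_ord i; lia.
rewrite add0r subrK lerD2r => /(_ tM)/eqP.
by rewrite mulf_eq0 -/(lead_coef q) lead_coef_eq0 (negPf q0) => /eqP.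
Qed.

Lemma shift_act_inj q s1 s2 : q != 0 -> delayed s1 -> delayed s2 ->
  shift_act q s1 =1 shift_act q s2 -> s1 =1 s2.
Proof.
move=> q0 D1 D2 H t; apply/eqP; rewrite -subr_eq0; apply/eqP.
apply: (@shift_act_vanish q (fun t => s1 t - s2 t) t) => //.
  exact: delayedD (delayedN D2).
by move=> t' _; rewrite shift_actBr H subrr.
Qed.

End ShiftAction.

(** * Filter outputs as solutions of difference equations *)

Section Filtering.
Variables (R : realType) (N : nat).
Implicit Types (G : transfer R) (u : 'I_N.+1 -> R).

(** Written as a sum of pulses so that it matches [filtered] term by term. *)
Definition extend0 u (t : int) : R := \sum_(k < N.+1) (t == k%:Z)%:R * u k.

Lemma extend0_ord u (t : 'I_N.+1) : extend0 u t%:Z = u t.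
Proof.
rewrite /extend0 (bigD1 t) //= eqxx mul1r big1 ?addr0 // => k kt.
by rewrite eqz_nat eq_sym (inj_eq val_inj) (negPf kt) mul0r.
Qed.

Lemma extend0_lt0 u (t : int) : t < 0 -> extend0 u t = 0.
Proof.
move=> t0; rewrite /extend0 big1 // => k _.
have /negPf -> : t != k%:Z by lia.
by rewrite mul0r.
Qed.

Lemma delayed_extend0 u : delayed (extend0 u).
Proof. by exists 0 => t; apply: extend0_lt0. Qed.

(** By linearity it suffices to treat a unit pulse at time [k], where the identity is
    [expansionP]. *)
Lemma shift_act_filtered G u :
  shift_act (tf_den G) (filtered G u) =1 shift_act (tf_num G) (extend0 u).
Proof.
move=> t; rewrite /shift_act /filtered /extend0.
under eq_bigr => i _ do rewrite big_distrr /=.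
under [RHS]eq_bigr => i _ do rewrite big_distrr /=.
rewrite exchange_big [RHS]exchange_big /=; apply: eq_bigr => k _.
under eq_bigr => i _ do rewrite mulrA.
under [RHS]eq_bigr => i _ do rewrite mulrA.
rewrite -!big_distrl /=; congr (_ * _).
transitivity (\sum_(i < size (tf_den G))
    (tf_den G)`_i * expansion G (i%:Z - (k%:Z - t))).
  by apply: eq_bigr => i _; congr (_ * expansion G _); ring.
(* Seen from time [t], the pulse at [k] selects the numerator coefficient of index [k - t]; nothing
   is selected when this index is negative or beyond the size. *)
rewrite expansionP; case E: (k%:Z - t) => [n|n]; last first.
  rewrite big1 // => i _.
  have /negPf -> : t + i%:Z != k%:Z by lia.
  by rewrite mulr0.
have [ns|sn] := ltnP n (size (tf_num G)).
  rewrite (bigD1 (Ordinal ns)) //= big1 => [|i ni].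
    have -> : t + n%:Z == k%:Z by lia.
  by rewrite mulr1 addr0.
  have : i != n :> nat by apply: contraNneq ni => ni; apply/eqP/val_inj.
  move=> {}ni; have /negPf -> : t + i%:Z != k%:Z by lia.
  by rewrite mulr0.
rewrite nth_default // big1 // => i _; have ltin := leq_trans (ltn_ord i) sn.
have /negPf -> : t + i%:Z != k%:Z by lia.
by rewrite mulr0.
Qed.

Lemma shift_act_filteredM p G u :
  shift_act (p * tf_den G) (filtered G u) =1
  shift_act (p * tf_num G) (extend0 u).
Proof.
by move=> t; rewrite !shift_actM; apply: eq_shift_act; apply: shift_act_filtered.
Qed.

Lemma delayed_filtered G u : delayed (filtered G u).
Proof.
(* An improper [G] anticipates its input by no more than the size of its polynomial part. *)
exists (- (size (tf_num G %/ tf_den G))%:Z) => t tm.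
rewrite /filtered big1 // => k _.
case E: (t - k%:Z) => [n|n]; first by lia.
have nm : (size (tf_num G %/ tf_den G)%R <= n.+1)%N by lia.
by rewrite /expansion nth_default ?mul0r.
Qed.

Lemma expansion_Negz G n : proper_tf G -> expansion G (Negz n) = 0.
Proof.
rewrite /proper_tf => pG; apply: nth_default.
rewrite size_divp ?tf_den_neq0 // leq_subLR; apply: leq_trans pG _.
by case: (size _) => // s; rewrite /= addnS ltnS leq_addr.
Qed.

Lemma filtered_lt0 G u (t : int) : proper_tf G -> t < 0 -> filtered G u t = 0.
Proof.
move=> pG t0; rewrite /filtered big1 // => k _.
case E: (t - k%:Z) => [n|n]; first by lia.
by rewrite expansion_Negz ?mul0r.
Qed.

End Filtering.

(** * Lower-triangular Toeplitz matrices as truncated convolutions *)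

Section ToeplitzMatrices.
Variable R : realType.

Lemma Tpl_mulmxE m (v w : 'cV[R]_m.+1) i :
  (Tpl v *m w) i 0 =
    \sum_(k < i.+1) v (inord (i - k)) 0 * w (inord k) 0.
Proof.
rewrite mxE (big_ord_widen m.+1
  (fun k : nat => v (inord (i - k)) 0 * w (inord k) 0)) ?ltn_ord //.
rewrite [RHS]big_mkcond; apply: eq_bigr => k _; rewrite mxE ltnS inord_val.
case: ifP => _; last by rewrite mul0r.
congr (v _ _ * _); apply: val_inj.
by rewrite /= inordK // (leq_ltn_trans (leq_subr _ _)).
Qed.

Lemma Tpl_mulmxC m (v w : 'cV[R]_m.+1) : Tpl v *m w = Tpl w *m v.
Proof.
apply/colP => i; rewrite !Tpl_mulmxE (reindex_inj rev_ord_inj).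
apply: eq_bigr => k _ /=; rewrite mulrC subSS subKn //.
by rewrite -ltnS.
Qed.

Lemma Tpl_unitmx m (v : 'cV[R]_m.+1) : v ord0 0 != 0 -> Tpl v \in unitmx.
Proof.
move=> v0; rewrite unitmxE det_trig.
  rewrite unitfE; apply/prodf_neq0 => i _; rewrite mxE leqnn.
  by rewrite (_ : Ordinal _ = ord0) //; apply: val_inj; rewrite /= subnn.
by apply/is_trig_mxP => i j ij; rewrite mxE leqNgt ij.
Qed.

(** The matrix is built from the input, so that the impulse response becomes the unknown vector of a
    linear system. *)
Lemma vec_response N (G : transfer R) (u : 'I_N.+1 -> R) : proper_tf G ->
  vec (response G u) = Tpl (vec u) *m vec (fun k : 'I_N.+1 => impulse G k).
Proof.
move=> pG; apply/colP => t; rewrite mxE responseE // Tpl_mulmxE.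
apply: eq_bigr => k _; rewrite !mxE mulrC inordK //.
exact: leq_trans (ltn_ord k) (ltn_ord t).
Qed.

End ToeplitzMatrices.

(** * Quadratic criteria and their minimizers *)

Section LeastSquares.
Variable R : realType.

Lemma euclidean_norm_vecB N (v w : 'I_N.+1 -> R) :
  euclidean_norm (vec v - vec w) ^+ 2 = N.+1%:R * mean_square_error v w.
Proof.
rewrite /mean_square_error mulrA divff ?pnatr_eq0 // mul1r.
rewrite sqr_sqrtr; last by apply: sumr_ge0 => i _; apply: sqr_ge0.
by apply: eq_bigr => i _; rewrite !mxE.
Qed.

Lemma argminZ (T : Type) (D : set T) (f g : T -> R) (c : R) : 0 < c ->
  (forall x, D x -> g x = c * f x) -> argmin D f = argmin D g.
Proof.
move=> c0 gE; apply/seteqP; split=> x [Dx fx]; split=> // y Dy.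
  by rewrite !gE // ler_pM2l // fx.
by rewrite -(ler_pM2l c0) -!gE // fx.
Qed.

End LeastSquares.

(** With [P = p / q] and [C = b / a], the closed loop is [p b / (q a + p b)]; the cross-multiplied
    form is the one that descends from fractions to polynomials. *)
Lemma feedback_cross_multiply (F : fieldType) (P C n d p q a b : F) :
  C != 0 -> 1 + P * C != 0 -> d != 0 -> q != 0 -> b != 0 ->
  P * C * (1 + P * C)^-1 = n / d -> P = p / q -> C^-1 = a / b ->
  n * (q * a + p * b) = d * (p * b).
Proof.
move=> C0 PC0 d0 q0 b0 TE PE CE.
have aE : a = C^-1 * b by rewrite CE mulfVK.
have pE : p = P * q by rewrite PE mulfVK.
have nE : n = P * C * (1 + P * C)^-1 * d by rewrite TE mulfVK.
by rewrite aE pE nE; field; rewrite ?C0 ?PC0.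
Qed.

(** * The closed loop driven by the fictitious reference *)

Section FictitiousReference.
Variables (R : realType) (N : nat) (P C : transfer R) (u : 'I_N.+1 -> R).
Hypotheses (C0 : C != 0) (PC0 : 1 + P * C != 0).
Hypothesis P_proper : proper_tf P.
Hypothesis Cinv_causal : forall t : int, t < 0 -> filtered C^-1 u t = 0.

Let T := unity_feedback (P * C).
Let y := response P u.
Let rtilde := fictitious_reference C u y.
Hypothesis rtilde0 : rtilde ord0 != 0.

(* rtilde is the restriction to 0..N of full_rtilde; only the untruncated
   signal satisfies an exact difference equation. *)
Let full_rtilde t := filtered C^-1 u t + filtered P u t.

Lemma unity_feedback_numden :
  tf_num T * (tf_den P * tf_num C^-1 + tf_num P * tf_den C^-1) =
  tf_den T * (tf_num P * tf_den C^-1).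
Proof.
have D0 (G : transfer R) : FracField.tofrac (tf_den G) != 0.
  by rewrite tofrac_eq0 tf_den_neq0.
have := feedback_cross_multiply C0 PC0 (D0 T) (D0 P) (D0 C^-1)
  (tf_numdenE T) (tf_numdenE P) (tf_numdenE C^-1).
rewrite -!tofracM -tofracD -!tofracM.
by move/eqP; rewrite tofrac_eq => /eqP.
Qed.

(** Multiplying by both denominators is injective on delayed signals and turns each side into a
    polynomial acting on [extend0 u]; the two polynomials agree by [unity_feedback_numden]. *)
Lemma shift_act_full_rtilde :
  shift_act (tf_den T) (filtered P u) =1 shift_act (tf_num T) full_rtilde.
Proof.
apply: (@shift_act_inj _ (tf_den P * tf_den C^-1)).
- by rewrite mulf_neq0 ?tf_den_neq0.
- exact/delayed_shift_act/delayed_filtered.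
- by apply/delayed_shift_act/delayedD; apply: delayed_filtered.
move=> t; rewrite -!shift_actM shift_actDr.
rewrite (_ : _ * tf_den T = tf_den C^-1 * tf_den T * tf_den P); last by ring.
rewrite (_ : _ * tf_num T = tf_den P * tf_num T * tf_den C^-1); last by ring.
rewrite shift_act_filteredM.
rewrite (shift_act_filteredM _ C^-1).
rewrite (_ : _ * tf_den C^-1 = tf_num T * tf_den C^-1 * tf_den P); last by ring.
rewrite shift_act_filteredM -shift_actDl.
congr shift_act.
transitivity (tf_den T * (tf_num P * tf_den C^-1)); first by ring.
by rewrite -unity_feedback_numden; ring.
Qed.

Lemma feedback_proper : proper_tf T.
Proof.
rewrite /proper_tf leqNgt; apply/negP => dn.
set m := (size (tf_num T)).-1.
have dm : (size (tf_den T) <= m)%N.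
  by rewrite -ltnS prednK // (leq_ltn_trans _ dn).
(* At time [-m] the left side sees only negative times, and the right side keeps only the leading
   coefficient of [tf_num T] times the nonzero value of [rtilde] at 0. *)
have := shift_act_full_rtilde (- m%:Z).
rewrite {1}/shift_act big1 => [|i _]; last first.
  by rewrite filtered_lt0 ?mulr0 //; have := leq_trans (ltn_ord i) dm; lia.
rewrite (@shift_act_widen _ _ _ _ m.+1) ?leqSpred // big_ord_recr /=.
rewrite big1 => [|i _]; last first.
  have t0 : - m%:Z + i%:Z < 0 by have := ltn_ord i; lia.
  by rewrite /full_rtilde Cinv_causal ?filtered_lt0 // addr0 mulr0.
rewrite add0r addNr => /esym/eqP; rewrite mulf_eq0 (negPf rtilde0) orbF.
rewrite -/(lead_coef _) lead_coef_eq0 => /eqP T0.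
by rewrite T0 size_poly0 in dn.
Qed.

Lemma response_fictitious_reference : response T rtilde = y.
Proof.
apply/funext => t; apply/eqP; rewrite -subr_eq0; apply/eqP.
have := @shift_act_vanish _ (tf_den T)
  (fun x => filtered T rtilde x - filtered P u x) N%:Z.
apply=> //; first exact: tf_den_neq0.
- by apply: delayedD (delayedN _); apply: delayed_filtered.
- move=> x xN; rewrite shift_actBr shift_act_filtered shift_act_full_rtilde.
  rewrite -shift_actBr /shift_act big1 // => i _.
  (* Properness of [T] keeps the samples used by the numerator within time [N], where [rtilde]
     extended by zero agrees with [full_rtilde]: by causality before 0, by definition afterwards. *)
  have xi : x + i%:Z <= N%:Z.
    rewrite -lerBrDr (le_trans xN) // lerD2l lerN2 lez_nat -ltnS prednK.
      exact: leq_trans (ltn_ord i) feedback_proper.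
    by rewrite size_poly_gt0 tf_den_neq0.
  have [x0|x0] := ltP (x + i%:Z) 0.
    rewrite /full_rtilde extend0_lt0 // Cinv_causal // filtered_lt0 //.
    by rewrite addr0 subr0 mulr0.
  case: (x + i%:Z) xi x0 => // k kN _.
  have kN' : (k < N.+1)%N by lia.
  by rewrite (extend0_ord rtilde (Ordinal kN')) subrr mulr0.
- by have := ltn_ord t; lia.
Qed.

(** That [T] maps [rtilde] to [y] is a triangular Toeplitz system in the impulse response; [rtilde0]
    makes its diagonal nonzero. *)
Lemma vec_impulse_feedback :
  vec (fun k : 'I_N.+1 => impulse T k) = invmx (Tpl (vec rtilde)) *m vec y.
Proof.
rewrite -response_fictitious_reference vec_response ?feedback_proper // mulKmx //.
by apply: Tpl_unitmx; rewrite mxE.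
Qed.

End FictitiousReference.

Theorem theorem1 (R : realType) (n N : nat)
  (P : transfer R)
  (Theta : set 'cV[R]_n) (C : 'cV[R]_n -> transfer R)
  (uD yD rD : 'I_N.+1 -> R)
  (Lflat_s : fractional_tf R) (wc : R)
  (approximation : fractional_tf R -> transfer R)
  (discretization : transfer R -> transfer R)
  (P_proper : proper_tf P)
  (C_proper : forall theta, Theta theta -> proper_tf (C theta))
  (C_neq0 : forall theta, Theta theta -> C theta != 0)
  (PC_neqN1 : forall theta, Theta theta -> 1 + P * C theta != 0)
  (yD_data : yD = response P uD)
  (Cinv_causal : forall theta, Theta theta ->
     forall t : int, t < 0 -> filtered (C theta)^-1 uD t = 0)
  (rtilde0_neq0 : forall theta, Theta theta ->
     fictitious_reference (C theta) uD yD ord0 != 0)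
  (rD0_neq0 : rD ord0 != 0)
  (wc_gt0 : 0 < wc)
  (Lflat_crossover : `|freq_response Lflat_s wc| = 1)
  (Lflat_flat_phase : flat_phase Lflat_s wc)
  (Lflat_proper : proper_tf (discretization (approximation Lflat_s)))
  (Lflat_neqN1 : 1 + discretization (approximation Lflat_s) != 0)
  (Mref_proper :
     proper_tf (unity_feedback (discretization (approximation Lflat_s))))
  (Mref_stable : forall p,
     pole (unity_feedback (discretization (approximation Lflat_s))) p ->
     `|p| < 1) :
  let T theta := unity_feedback (P * C theta) in
  let Lflat_z := discretization (approximation Lflat_s) in
  let Mref := unity_feedback Lflat_z in
  let mref : 'I_N.+1 -> R := fun k => impulse Mref k in
  let RD := Tpl (vec rD) in
  let Rtilde theta := Tpl (vec (fictitious_reference (C theta) uD yD)) in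
  let J theta :=
    euclidean_norm (RD *m invmx (Rtilde theta) *m vec yD - RD *m vec mref)
      ^+ 2 in
  argmin Theta (fun theta =>
      mean_square_error (response (T theta) rD) (response Mref rD))
    = argmin Theta J.
Proof.
move=> T Lflat_z Mref mref RD Rtilde J.
apply: (@argminZ _ _ _ _ _ N.+1%:R) => [|theta Dtheta]; first by rewrite ltr0n.
have rtilde0 : fictitious_reference (C theta) uD (response P uD) ord0 != 0.
  by rewrite -yD_data; exact: rtilde0_neq0.
have T_prop := feedback_proper (C_neq0 _ Dtheta) (PC_neqN1 _ Dtheta) P_proper
  (Cinv_causal _ Dtheta) rtilde0.
have mT := vec_impulse_feedback (C_neq0 _ Dtheta) (PC_neqN1 _ Dtheta) P_proper
  (Cinv_causal _ Dtheta) rtilde0.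
(* Both responses to [rD] are [RD] times an impulse response, and [mT] expresses that of [T] through
   the data and the fictitious reference. *)
rewrite -euclidean_norm_vecB (vec_response _ T_prop) (vec_response _ Mref_proper).
by rewrite mT /J /Rtilde yD_data mulmxA.
Qed.
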